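(* Let $a_{i,j},b_{i,j}>0$ for $i,j\in\mathbb Z$. The evolution of the face weights under the domino shuffle and under the map $\{M_i\}_{i\in\mathbb Z}\mapsto\{\hat M_i\}_{i\in\mathbb Z}$ on transition matrices is the same. That is: starting from the dimer graph with the edge weights determined by $(a_{i,j}),(b_{i,j})$ (with face weights $F_{2i,j}=a_{i,j}/b_{i,j}$ at $(2i+1,2j+1)$ and $F_{2i+1,j}=b_{i+1,j+1}/a_{i+1,j}$ at $(2i+2,2j+2)$), after applying the domino shuffle the face weight at $(2i+1,2j+1)$ is $\hat F_{2i,j}$ and the face weight at $(2i+2,2j+2)$ is $\hat F_{2i+1,j}$ for all $i,j\in\mathbb Z$, where $\hat F_{2i,j}=\hat a_{i,j}/\hat b_{i,j}$ and $\hat F_{2i+1,j}=\hat b_{i+1,j+1}/\hat a_{i+1,j}$ are the face weights associated with $\{\hat M_i\}_{i\in\mathbb Z}$.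
   Context: Dimer graph: white vertices $\mathtt W=\{(i,j)\in\mathbb Z^2: i\text{ odd}, j\text{ even}\}$, black vertices $\mathtt B=\{(i,j)\in\mathbb Z^2:i\text{ even}, j\text{ odd}\}$, with edges joining black and white vertices differing by $(\pm1,\pm1)$. Faces are squares centred at points $(2i+1,2j+1)$ (even faces) and $(2i+2,2j+2)$ (odd faces). For the black vertex $\mathtt b=(2i,2j+1)$ the edges to $(2i-1,2j+2)$ and $(2i-1,2j)$ have weight $1$, the edge to $(2i+1,2j+2)$ has weight $a_{i,j}$ and the edge to $(2i+1,2j)$ has weight $b_{i,j}$. The face weight of a face is the alternating product of its edge weights, going clockwise around the face: edges traversed from black to white are in the numerator, edges traversed from white to black in the denominator. Domino shuffle: (1) Square move at every even face: if the edge weights around the face are $a,b,c,d$ (clockwise starting from the NE edge), replace the square by a smaller square with edge weights $A=c/\Delta$, $B=d/\Delta$, $C=a/\Delta$, $D=b/\Delta$ (same labelling), $\Delta=ac+bd$, and join each vertex of the smaller square to the corresponding original vertex by an edge of weight $1$ (so each vertex of the smaller square has colour opposite to the original vertex). (2) Edge contraction: for every two-valent vertex (here, every original vertex) with both incident edges of weight $1$, contract the two incident edges. This gives again the square lattice with the colours of the vertices interchanged. (3) Translate by $(-1,1)$, so that the face at $(2i+1,2j+1)$ moves to $(2i,2j+2)$; the colouring is then the original one. Map on transition matrices: let $S$ be the $\mathbb Z\times\mathbb Z$ shift matrix, $S_{ij}=1$ if $i=j+1$ and $0$ otherwise; $\Psi=\sum_{k\ge0}S^k$; $D(\mathtt a)$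 the diagonal matrix with entries of $\mathtt a=(\mathtt a_j)_{j\in\mathbb Z}$; $\sigma(\mathtt b)=(b_{j-1})_{j\in\mathbb Z}$. With $\mathtt a_i=(a_{i,j})_{j}$, $\mathtt b_i=(b_{i,j})_j$, let $M_{2i}=D(\mathtt a_i)+D(\mathtt b_i)S$, $M_{2i+1}=\Psi$, $X_i=D(\mathtt a_i+\mathtt b_i)$, and define $\hat M_{2i}=(D(\mathtt a_i)+D(\sigma(\mathtt b_i))S)X_i^{-1}X_{i+1}$, $\hat M_{2i+1}=\Psi$, so that $M_{2i}M_{2i+1}=X_i\hat M_{2i+1}\hat M_{2i}X_{i+1}^{-1}$. Then $\hat M_{2i}=D(\hat{\mathtt a}_i)+D(\hat{\mathtt b}_i)S$ with $$\hat a_{i,j}=a_{i,j}\frac{a_{i+1,j}+b_{i+1,j}}{a_{i,j}+b_{i,j}},\qquad \hat b_{i,j}=b_{i,j-1}\frac{a_{i+1,j-1}+b_{i+1,j-1}}{a_{i,j-1}+b_{i,j-1}}.$$ *)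

(* Defs.v *)
From HB Require Import structures.
From mathcomp Require Import all_boot all_order all_algebra.
From mathcomp Require Import boolp classical_sets fsbigop.
From Stdlib Require Import Relations.

Set Implicit Arguments.
Unset Strict Implicit.
Unset Printing Implicit Defensive.

Import Order.TTheory GRing.Theory Num.Theory.
Local Open Scope classical_set_scope.
Local Open Scope ring_scope.

(* Bipartite weighted graphs with vertices among the elements of V: a vertex
   is an element of V which is black or white, and two vertices are joined by
   an edge iff the (symmetric) weight of the pair is nonzero. *)
Record wgraph (R : fieldType) (V : Type) := WGraph {
  isblack : V -> bool;
  iswhite : V -> bool;
  wt : V -> V -> R }.

Definition zpoint : Type := (int * int)%type.

Definition evenz (x : int) : bool := (2 %| x)%Z.
Definition oddz (x : int) : bool := ~~ evenz x.

(* The corners of the square face with centre f. *)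
Definition north (f : zpoint) : zpoint := (f.1, f.2 + 1).
Definition east (f : zpoint) : zpoint := (f.1 + 1, f.2).
Definition south (f : zpoint) : zpoint := (f.1, f.2 - 1).
Definition west (f : zpoint) : zpoint := (f.1 - 1, f.2).

Definition is_corner (f v : zpoint) : bool :=
  v \in [:: north f; east f; south f; west f].

Definition even_face (f : zpoint) : bool := oddz f.1 && oddz f.2.

Definition same_edge (u v p q : zpoint) : bool :=
  ((u == p) && (v == q)) || ((u == q) && (v == p)).

Definition face_edge (f u v : zpoint) : bool :=
  [|| same_edge u v (north f) (east f), same_edge u v (east f) (south f),
      same_edge u v (south f) (west f) | same_edge u v (west f) (north f)].

Section DimerGraph.
Context {R : fieldType}.

Definition dimer_black (v : zpoint) : bool := evenz v.1 && oddz v.2.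
Definition dimer_white (v : zpoint) : bool := oddz v.1 && evenz v.2.

(* Weight of the pair (p, q) for p black: if p = (2i, 2j+1) then
   i = p.1 %/ 2 and j = p.2 %/ 2, as %/ rounds down. *)
Definition black_wt (a b : int -> int -> R) (p q : zpoint) : R :=
  if (q == (p.1 - 1, p.2 + 1)) || (q == (p.1 - 1, p.2 - 1)) then 1
  else if q == (p.1 + 1, p.2 + 1) then a (p.1 %/ 2)%Z (p.2 %/ 2)%Z
  else if q == (p.1 + 1, p.2 - 1) then b (p.1 %/ 2)%Z (p.2 %/ 2)%Z
  else 0.

Definition dimer_graph (a b : int -> int -> R) : wgraph R zpoint :=
  {| isblack := dimer_black;
     iswhite := dimer_white;
     wt := fun p q =>
       if dimer_black p then black_wt a b p q
       else if dimer_black q then black_wt a b q p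
       else 0 |}.

Definition edge_factor (G : wgraph R zpoint) (p q : zpoint) : R :=
  if isblack G p then wt G p q else (wt G p q)^-1.

Definition face_weight (G : wgraph R zpoint) (f : zpoint) : R :=
  edge_factor G (west f) (north f) * edge_factor G (north f) (east f) *
  edge_factor G (east f) (south f) * edge_factor G (south f) (west f).

(* Square move at all even faces. The vertex inl v is the original vertex v,
   and inr (f, v) is the vertex of the smaller square in the even face f that
   is joined to the corner v of f. *)
Definition sq_vertex : Type := (zpoint + zpoint * zpoint)%type.

Definition small_wt (G : wgraph R zpoint) (f u v : zpoint) : R :=
  let a := wt G (north f) (east f) in
  let b := wt G (east f) (south f) in
  let c := wt G (south f) (west f) in
  let d := wt G (west f) (north f) in
  let Delta := a * c + b * d in
  if same_edge u v (north f) (east f) then c / Delta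
  else if same_edge u v (east f) (south f) then d / Delta
  else if same_edge u v (south f) (west f) then a / Delta
  else if same_edge u v (west f) (north f) then b / Delta
  else 0.

Definition spoke_wt (v f u : zpoint) : R :=
  if [&& even_face f, is_corner f u & u == v] then 1 else 0.

Definition square_move (G : wgraph R zpoint) : wgraph R sq_vertex :=
  {| isblack := fun x => match x with
       | inl v => isblack G v
       | inr (f, v) => [&& even_face f, is_corner f v & iswhite G v]
       end;
     iswhite := fun x => match x with
       | inl v => iswhite G v
       | inr (f, v) => [&& even_face f, is_corner f v & isblack G v]
       end;
     wt := fun x y => match x, y with
       | inl u, inl v =>
           if `[< exists2 f, even_face f & face_edge f u v >] then 0
           else wt G u v
       | inl v, inr (f, u) => spoke_wt v f u
       | inr (f, u), inl v => spoke_wt v f u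
       | inr (f, u), inr (g, v) =>
           if even_face f && (f == g) then small_wt G f u v else 0
       end |}.

Section Contraction.
Context {V : choiceType}.

Definition two_valent_unit (G : wgraph R V) (v : V) : Prop :=
  exists u1 u2, [/\ u1 <> u2, wt G v u1 = 1, wt G v u2 = 1 &
    forall u, wt G v u != 0 -> u = u1 \/ u = u2].

Definition merged (G : wgraph R V) : V -> V -> Prop :=
  clos_refl_sym_trans V (fun x y => two_valent_unit G x /\ wt G x y != 0).

(* Contraction of both edges at all two-valent vertices with unit weights. The
   vertices of the result are the classes of merged vertices; pos names the
   class of pos p by p. A class takes the colour of its members that are not
   two-valent, and the weights of parallel edges would be added. *)
Definition contract (G : wgraph R V) (P : Type) (pos : P -> V) : wgraph R P :=
  {| isblack := fun p =>
       `[< exists x, [/\ merged G (pos p) x, ~ two_valent_unit G x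
                         & isblack G x] >];
     iswhite := fun p =>
       `[< exists x, [/\ merged G (pos p) x, ~ two_valent_unit G x
                         & iswhite G x] >];
     wt := fun p q =>
       if `[< merged G (pos p) (pos q) >] then 0
       else \sum_(xy \in merged G (pos p) `*` merged G (pos q))
              wt G xy.1 xy.2 |}.

End Contraction.

Definition translate (t : zpoint) (G : wgraph R zpoint) : wgraph R zpoint :=
  let back (v : zpoint) : zpoint := (v.1 - t.1, v.2 - t.2) in
  {| isblack := fun v => isblack G (back v);
     iswhite := fun v => iswhite G (back v);
     wt := fun u v => wt G (back u) (back v) |}.

Definition domino_shuffle (G : wgraph R zpoint) : wgraph R zpoint :=
  translate (-1, 1)
    (contract (square_move G) (fun v : zpoint => (inl v : sq_vertex))).

End DimerGraph.

Section TransitionMatrices.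
Context {R : fieldType}.

Definition zmx : Type := int -> int -> R.

Definition zadd (A B : zmx) : zmx := fun i j => A i j + B i j.

(* The sums are over the indices with a nonzero term, which are finite in
   number for all the products and for the series Psi below. *)
Definition zmul (A B : zmx) : zmx :=
  fun i j => \sum_(k \in [set: int]) A i k * B k j.

Definition zdiag (d : int -> R) : zmx := fun i j => if i == j then d i else 0.

Definition zexp (A : zmx) (n : nat) : zmx := iter n (zmul A) (zdiag (fun=> 1)).

Definition shift_mx : zmx := fun i j => if i == j + 1 then 1 else 0.

Definition Psi : zmx := fun i j => \sum_(k \in [set: nat]) zexp shift_mx k i j.

Definition sigma (b : int -> R) : int -> R := fun j => b (j - 1).

Implicit Types a b : int -> int -> R.

Definition trans_mx a b (k : int) : zmx :=
  let i := (k %/ 2)%Z in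
  if evenz k then zadd (zdiag (a i)) (zmul (zdiag (b i)) shift_mx) else Psi.

Definition X_mx a b (i : int) : zmx := zdiag (fun j => a i j + b i j).
Definition X_inv a b (i : int) : zmx := zdiag (fun j => (a i j + b i j)^-1).

Definition hat_trans_mx a b (k : int) : zmx :=
  let i := (k %/ 2)%Z in
  if evenz k then
    zmul (zmul (zadd (zdiag (a i)) (zmul (zdiag (sigma (b i))) shift_mx))
               (X_inv a b i))
         (X_mx a b (i + 1))
  else Psi.

Definition hat_a a b (i j : int) : R :=
  a i j * ((a (i + 1) j + b (i + 1) j) / (a i j + b i j)).

Definition hat_b a b (i j : int) : R :=
  b i (j - 1) *
    ((a (i + 1) (j - 1) + b (i + 1) (j - 1)) / (a i (j - 1) + b i (j - 1))).

(* F_even a b i j and F_odd a b i j are the face weights with indices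
   (2i, j) and (2i + 1, j) of the transition matrices with entries a, b. *)
Definition F_even a b (i j : int) : R := a i j / b i j.
Definition F_odd a b (i j : int) : R := b (i + 1) (j + 1) / a (i + 1) j.

End TransitionMatrices.

Arguments zmx : clear implicits.

(* Main.v *)
Require Import Defs.
From mathcomp Require Import all_boot all_order all_algebra.
From mathcomp Require Import boolp classical_sets fsbigop.
From mathcomp Require Import zify ring.
From Stdlib Require Import Relations.

Import Order.TTheory GRing.Theory Num.Theory.
Local Open Scope ring_scope.

(** The weights of the shuffled graph are local functions of the original ones,
    so both evolutions can be computed and compared. Write
    D i j = a i j + b i j.

    Every edge of the lattice borders exactly one even face, and every vertex is
    a corner of exactly two even faces. Hence the square move destroys all the
    original edges, and each original vertex is left with two unit spokes, one
    in each of its two even faces. A vertex of a small square has degree three,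
    so the two-valent vertices are exactly the original ones
    ([two_valent_original], [lattice_two_valent]), and contraction merges each
    original vertex v with the two small-square vertices at v and nothing else
    ([mergedE]). Two small-square vertices are adjacent only inside one face.
    So the contracted graph is the lattice with the two colours exchanged
    ([contract_black]), in which an edge of the even face f carries the weight
    of the corresponding edge of the small square in f ([contract_wt]).

    For the dimer graph, the even face centred at (2i+1, 2j+1) has weights
    1, 1, b i j, a i j clockwise from the NE edge, so its small square has
    weights b i j / D i j, a i j / D i j, 1 / D i j, 1 / D i j
    ([shuffled_wts]). An even face of the contracted graph therefore has weight
    b / a. An odd face takes one edge from each of the four surrounding small
    squares, and its weight is
<<
      (a i (j+1) / D i (j+1)) * D (i+1) (j+1)
        / ((b i j / D i j) * D (i+1) j).
>>
    The translation by (-1, 1) exchanges even and odd faces, and the two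
    formulas become the ratios of the hatted weights: in the second one each
    factor is of the form weight * D (i+1) / D i, which is how the hatted
    weights are defined, while in the first one the common factor
    D (i+2) j / D (i+1) j of the two hatted weights cancels. *)

(** * The lattice and its even faces *)

(** Turns membership of faces, corners and edges into linear arithmetic and
    parity conditions on integer coordinates, which [lia] decides. *)
Ltac unfold_lattice :=
  rewrite /even_face /oddz /evenz /face_edge /same_edge /is_corner
    /north /east /south /west ?inE /= ?xpair_eqE /=.

Lemma zpoint_eq (p q : zpoint) : (p.1 == q.1) && (p.2 == q.2) -> p = q.
Proof. by case: p q => [? ?] [? ?] /andP[/eqP /= -> /eqP ->]. Qed.

Definition lattice_vertex (v : zpoint) : bool := evenz v.1 (+) evenz v.2.

(** The even faces at a vertex lie to its west and east if the vertex is black,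
    and to its south and north if it is white. *)
Definition low_face (v : zpoint) : zpoint :=
  if evenz v.1 then west v else south v.

Definition high_face (v : zpoint) : zpoint :=
  if evenz v.1 then east v else north v.

Lemma low_high_face (v : zpoint) : low_face v != high_face v.
Proof.
by case: v => x y; rewrite /low_face /high_face; case: ifP => _;
   unfold_lattice; lia.
Qed.

Lemma even_face_at (f v : zpoint) :
  even_face f && is_corner f v =
  lattice_vertex v && ((f == low_face v) || (f == high_face v)).
Proof.
case: f v => [f1 f2] [x y]; rewrite /lattice_vertex /low_face /high_face /=.
case: ifP; unfold_lattice; lia.
Qed.

(** The two ends of an edge differ in the parity of each coordinate, and the
    centre of its even face collects the odd ones. In particular this face is
    unique, so an edge of the contracted graph comes from a single small
    square. *)
Lemma even_face_of_edge {f u v : zpoint} :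
  even_face f -> face_edge f u v ->
  f = (if evenz u.1 then v.1 else u.1, if evenz u.2 then v.2 else u.2).
Proof.
case: f u v => [f1 f2] [u1 u2] [v1 v2] ef e; apply/eqP; move: ef e.
by case: ifP; case: ifP; unfold_lattice; lia.
Qed.

Lemma face_edgeC (f u v : zpoint) : face_edge f u v = face_edge f v u.
Proof. by rewrite /face_edge /same_edge; lia. Qed.

Lemma face_edge_corner {f u v : zpoint} : face_edge f u v -> is_corner f u.
Proof. by case: f u v => [f1 f2] [u1 u2] [v1 v2]; unfold_lattice; lia. Qed.

Lemma face_edge_neq {f u v : zpoint} : face_edge f u v -> u != v.
Proof. by case: f u v => [f1 f2] [u1 u2] [v1 v2]; unfold_lattice; lia. Qed.

(** What keeps small-square vertices from being two-valent: together with the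
    spoke, the two sides give degree three. *)
Lemma corner_neighbours {f v : zpoint} :
  is_corner f v -> exists n m, [/\ n != m, face_edge f v n & face_edge f v m].
Proof.
case: f v => [f1 f2] [x y].
have [-> | ne] := eqVneq x f1 => fv.
  by exists (f1 + 1, f2), (f1 - 1, f2); split; move: fv; unfold_lattice; lia.
by exists (f1, f2 + 1), (f1, f2 - 1); split; move: ne fv; unfold_lattice; lia.
Qed.

(** * Square move and contraction *)

Section Shuffle.

(** The combinatorics of the contraction only depends on where the weights
    vanish, so it is carried out for any graph whose edges all border even faces
    and whose small squares have nonzero weights. *)

Context {R : fieldType} {G : wgraph R zpoint}.

Hypothesis small_edge_neq0 : forall f u v : zpoint,
  even_face f -> face_edge f u v -> small_wt G f u v != 0.
Hypothesis wt_on_even_face : forall u v : zpoint,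
  wt G u v != 0 -> exists2 f, even_face f & face_edge f u v.

Let H := square_move G.

Lemma small_wt_edge {f u v : zpoint} :
  small_wt G f u v != 0 -> face_edge f u v.
Proof.
rewrite /small_wt /face_edge; do 4!case: ifP => //= _.
by rewrite eqxx.
Qed.

Lemma wt_inlinl (u v : zpoint) : wt H (inl u) (inl v) = 0.
Proof.
rewrite /=; case: asboolP => // nf.
by apply/eqP/negP => /negP /wt_on_even_face.
Qed.

Lemma spoke_wt_neq0 {v f u : zpoint} : (spoke_wt v f u : R) != 0 ->
  [/\ even_face f, is_corner f u & u = v].
Proof.
rewrite /spoke_wt; case: ifP => [/and3P[ef fu /eqP uv] _ | _]; first by split.
by rewrite eqxx.
Qed.

Lemma spoke_wt1 {f v : zpoint} : even_face f -> is_corner f v ->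
  spoke_wt v f v = 1 :> R.
Proof. by rewrite /spoke_wt eqxx => -> ->. Qed.

(** An index (f, v) with a nonzero weight is a genuine vertex of a small square,
    and its spoke and two sides then lead to three distinct neighbours. *)
Lemma two_valent_original {x : sq_vertex} :
  two_valent_unit H x -> exists v, x = inl v.
Proof.
case: x => [v | [f v]]; first by exists v.
case=> y1 [y2 [_ y1E _ nbr]].
have [ef fv] : even_face f /\ is_corner f v.
  have : wt H (inr (f, v)) y1 != 0 by rewrite y1E oner_neq0.
  case: (y1) => [u | [g u]] /=; first by case/spoke_wt_neq0.
  case: andP => [[ef _] | _]; last by rewrite eqxx.
  by move/small_wt_edge/face_edge_corner.
have [n [m [nm vn vm]]] := corner_neighbours fv.
have /nbr y0 : wt H (inr (f, v)) (inl v) != 0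
  by rewrite /= (spoke_wt1 ef fv) oner_neq0.
have /nbr yn : wt H (inr (f, v)) (inr (f, n)) != 0
  by rewrite /= ef eqxx small_edge_neq0.
have /nbr ym : wt H (inr (f, v)) (inr (f, m)) != 0
  by rewrite /= ef eqxx small_edge_neq0.
case: y0 yn ym => <- [] // yn [] // ym; move: nm.
  by move: ym; rewrite -yn => -[->]; rewrite eqxx.
by move: ym; rewrite -yn => -[->]; rewrite eqxx.
Qed.

Lemma lattice_two_valent (v : zpoint) :
  lattice_vertex v -> two_valent_unit H (inl v).
Proof.
move=> lv.
have [el cl] : even_face (low_face v) /\ is_corner (low_face v) v.
  by apply/andP; rewrite even_face_at lv eqxx.
have [eh ch] : even_face (high_face v) /\ is_corner (high_face v) v.
  by apply/andP; rewrite even_face_at lv eqxx orbT.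
exists (inr (low_face v, v)), (inr (high_face v, v)); split.
- by case=> /eqP; rewrite (negbTE (low_high_face v)).
- by rewrite /= spoke_wt1.
- by rewrite /= spoke_wt1.
case=> [u | [f u]]; first by rewrite wt_inlinl eqxx.
case/spoke_wt_neq0 => ef fu <-.
have : even_face f && is_corner f u by rewrite ef.
by rewrite even_face_at => /andP[_ /orP[] /eqP ->]; [left | right].
Qed.

(** An invariant of merging: the only nonzero weights at a two-valent vertex are
    those of its spokes, and [attached] is constant along spokes. *)
Definition attached (x : sq_vertex) : sq_vertex :=
  match x with
  | inl v => inl v
  | inr (f, v) => if even_face f && is_corner f v then inl v else x
  end.

Lemma merged_attached {x y : sq_vertex} :
  merged H x y -> attached x = attached y.
Proof.
elim=> {x y} [x y [tx xy] | // | x y _ -> // | x y z _ -> _ -> //].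
have [v xv] := two_valent_original tx; move: xy; rewrite {}xv.
case: y => [u | [f u]]; first by rewrite wt_inlinl eqxx.
by case/spoke_wt_neq0 => /= -> -> ->.
Qed.

Lemma merged_spoke {f v : zpoint} : even_face f -> is_corner f v ->
  merged H (inl v) (inr (f, v)).
Proof.
move=> ef fv; apply: rst_step; split; last first.
  by rewrite /= spoke_wt1 // oner_neq0.
apply: lattice_two_valent.
have : even_face f && is_corner f v by rewrite ef.
by rewrite even_face_at => /andP[].
Qed.

Lemma mergedE {v : zpoint} {x : sq_vertex} : merged H (inl v) x ->
  x = inl v \/ exists2 f, even_face f && is_corner f v & x = inr (f, v).
Proof.
move/merged_attached; case: x => [u [->] | [f u] /=]; first by left.
by case: ifP => // fu [vu]; right; exists f; rewrite vu.
Qed.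

Let K := contract H (fun v : zpoint => inl v : sq_vertex).

(** The class of u consists of u and its two small-square vertices, and likewise
    for v. Among the pairs of members, original vertices contribute nothing, and
    small-square vertices are adjacent only in an even face having uv as a side,
    that is, in f. *)
Lemma contract_wt {f u v : zpoint} : even_face f -> face_edge f u v ->
  wt K u v = small_wt G f u v.
Proof.
move=> ef fuv; have fu := face_edge_corner fuv.
have fv : is_corner f v by move: fuv; rewrite face_edgeC => /face_edge_corner.
have uv := face_edge_neq fuv.
rewrite [LHS]/=; case: asboolP => [/merged_attached [/eqP] | _].
  by rewrite (negbTE uv).
pose e : sq_vertex * sq_vertex := (inr (f, u), inr (f, v)).
rewrite -(@fsbig_widen _ _ _ _ [set e]%classic).
- by rewrite fsbig_set1 /= ef eqxx.
- by move=> _ ->; split; apply: merged_spoke.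
case=> x y [[/= ux vy] ne]; apply: (_ : wt H x y = 0).
case: (mergedE ux) (mergedE vy) ne => [-> | [g _ ->]] [-> | [h _ ->]] ne.
- by rewrite wt_inlinl.
- by rewrite /= /spoke_wt eq_sym (negbTE uv) !andbF.
- by rewrite /= /spoke_wt (negbTE uv) !andbF.
rewrite /=; case: ifP => // /andP[eg /eqP gh]; apply/eqP/negP.
move=> /negP /small_wt_edge guv.
case: ne; rewrite /e -gh.
by rewrite (even_face_of_edge ef fuv) (even_face_of_edge eg guv).
Qed.

Hypothesis vertex_lattice : forall v : zpoint,
  isblack G v || iswhite G v -> lattice_vertex v.

(** The members of a class that are not two-valent are the small-square vertices
    at v, whose colour is opposite to that of v. *)
Lemma contract_black (v : zpoint) : isblack K v = iswhite G v.
Proof.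
rewrite [LHS]/=; apply/asboolP/idP => [[x [vx nx bx]] | wv].
  case: (mergedE vx) nx bx => [-> nx /= bx | [f _ -> _ /and3P[]//]].
  by case: nx; apply/lattice_two_valent/vertex_lattice; rewrite bx.
have lv : lattice_vertex v by apply: vertex_lattice; rewrite wv orbT.
have /andP[el cl] : even_face (low_face v) && is_corner (low_face v) v.
  by rewrite even_face_at lv eqxx.
exists (inr (low_face v, v)); split; first exact: merged_spoke.
- by case/two_valent_original.
- by rewrite /= el cl.
Qed.

End Shuffle.

Section SmallSquare.

Context {R : fieldType} (G : wgraph R zpoint) (f : zpoint).

Definition face_delta : R :=
  wt G (north f) (east f) * wt G (south f) (west f)
  + wt G (east f) (south f) * wt G (west f) (north f).

Lemma small_wtC (u v : zpoint) : small_wt G f u v = small_wt G f v u.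
Proof.
have seC p q : same_edge u v p q = same_edge v u p q.
  by rewrite /same_edge orbC andbC [(u == p) && _]andbC.
by rewrite /small_wt !seC.
Qed.

Lemma small_wt_NE :
  small_wt G f (north f) (east f) = wt G (south f) (west f) / face_delta.
Proof. by rewrite /small_wt /same_edge !eqxx. Qed.

Lemma small_wt_SE :
  small_wt G f (east f) (south f) = wt G (west f) (north f) / face_delta.
Proof.
rewrite /small_wt; case: ifP; first by case: f => x y; unfold_lattice; lia.
by rewrite /same_edge !eqxx.
Qed.

Lemma small_wt_SW :
  small_wt G f (south f) (west f) = wt G (north f) (east f) / face_delta.
Proof.
rewrite /small_wt; do 2!
  [case: ifP; first by case: f => x y; unfold_lattice; lia].
by rewrite /same_edge !eqxx.
Qed.

Lemma small_wt_NW :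
  small_wt G f (west f) (north f) = wt G (east f) (south f) / face_delta.
Proof.
rewrite /small_wt; do 3!
  [case: ifP; first by case: f => x y; unfold_lattice; lia].
by rewrite /same_edge !eqxx.
Qed.

Lemma small_wt_neq0 (u v : zpoint) :
  wt G (north f) (east f) != 0 -> wt G (east f) (south f) != 0 ->
  wt G (south f) (west f) != 0 -> wt G (west f) (north f) != 0 ->
  face_delta != 0 -> face_edge f u v -> small_wt G f u v != 0.
Proof.
move=> ne se sw nw delta; rewrite /face_edge /small_wt -/face_delta.
by do 4![case: ifP => [_ _ | _ /=]; first by rewrite mulf_neq0 ?invr_eq0].
Qed.

End SmallSquare.

Lemma face_weight_translate {R : fieldType} (G : wgraph R zpoint) (t f : zpoint) :
  face_weight (translate t G) f = face_weight G (f.1 - t.1, f.2 - t.2).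
Proof.
by rewrite /face_weight /edge_factor /= ![_ + 1 - _]addrAC ![_ - 1 - _]addrAC.
Qed.

(** * The shuffle of the dimer graph *)


(** At explicit points, every test on colours and positions is settled by
    parity or by comparing coordinates. *)
Ltac decide_ifs :=
  repeat match goal with |- context [if ?c then _ else _] =>
    first [have -> : c = true by lia | have -> : c = false by lia]
  end.

Ltac unfold_dimer :=
  rewrite /dimer_black /dimer_white /black_wt; unfold_lattice.

Section Dimer.

Context {R : fieldType} {a b : int -> int -> R}.

Let G := dimer_graph a b.

Lemma dimer_vertex_lattice (v : zpoint) :
  isblack G v || iswhite G v -> lattice_vertex v.
Proof.
by rewrite /= /dimer_black /dimer_white /lattice_vertex /oddz; lia.
Qed.

Lemma dimer_wt_on_even_face (u v : zpoint) :
  wt G u v != 0 -> exists2 f, even_face f & face_edge f u v.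
Proof.
have black_case p q : dimer_black p -> black_wt a b p q != 0 ->
    even_face (q.1, p.2) && face_edge (q.1, p.2) p q.
  case: p q => [p1 p2] [q1 q2]; unfold_dimer => bp.
  case: ifP => [h _ | n1]; first lia.
  case: ifP => [h _ | n2]; first lia.
  case: ifP => [h _ | n3]; first lia.
  by rewrite eqxx.
rewrite /=; case: ifP => bu; last case: ifP => bv.
- by case/(black_case _ _ bu)/andP; exists (v.1, u.2).
- case/(black_case _ _ bv)/andP => e; rewrite face_edgeC; exists (u.1, v.2) => //.
by rewrite eqxx.
Qed.

Definition even_centre (i j : int) : zpoint := (2 * i + 1, 2 * j + 1).
Definition odd_centre (i j : int) : zpoint := (2 * i + 2, 2 * j + 2).

Lemma even_face_centre (i j : int) : even_face (even_centre i j).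
Proof. by rewrite /even_centre; unfold_lattice; lia. Qed.

Section EvenFace.

Variables i j : int.
Let f := even_centre i j.

Lemma dimer_wt_NE : wt G (north f) (east f) = 1.
Proof. by rewrite /f /even_centre /=; unfold_dimer; decide_ifs. Qed.

Lemma dimer_wt_SE : wt G (east f) (south f) = 1.
Proof. by rewrite /f /even_centre /=; unfold_dimer; decide_ifs. Qed.

Lemma dimer_wt_SW : wt G (south f) (west f) = b i j.
Proof.
by rewrite /f /even_centre /=; unfold_dimer; decide_ifs; congr b; lia.
Qed.

Lemma dimer_wt_NW : wt G (west f) (north f) = a i j.
Proof.
by rewrite /f /even_centre /=; unfold_dimer; decide_ifs; congr a; lia.
Qed.

Lemma dimer_delta : face_delta G f = a i j + b i j.
Proof.
rewrite /face_delta dimer_wt_NE dimer_wt_SE dimer_wt_SW dimer_wt_NW !mul1r.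
by rewrite addrC.
Qed.

End EvenFace.

Lemma dimer_face_weight_even (i j : int) :
  face_weight G (even_centre i j) = F_even a b i j.
Proof.
rewrite /face_weight /edge_factor dimer_wt_NE dimer_wt_SE dimer_wt_SW dimer_wt_NW.
by rewrite /even_centre /=; unfold_dimer; decide_ifs; rewrite invr1 !mulr1.
Qed.

Lemma dimer_face_weight_odd (i j : int) :
  face_weight G (odd_centre i j) = F_odd a b i j.
Proof.
rewrite /face_weight /edge_factor /odd_centre /=; unfold_dimer; decide_ifs.
rewrite invr1 mul1r mulr1 /F_odd.
by congr (b _ _ / a _ _); lia.
Qed.

Hypothesis a_neq0 : forall i j, a i j != 0.
Hypothesis b_neq0 : forall i j, b i j != 0.
Hypothesis ab_neq0 : forall i j, a i j + b i j != 0.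

Lemma dimer_small_wt_neq0 (f u v : zpoint) :
  even_face f -> face_edge f u v -> small_wt G f u v != 0.
Proof.
move=> ef; have -> : f = even_centre (f.1 %/ 2)%Z (f.2 %/ 2)%Z.
  by apply/eqP; case: f ef => x y; rewrite /even_centre; unfold_lattice; lia.
by apply: small_wt_neq0;
   rewrite ?dimer_wt_NE ?dimer_wt_SE ?dimer_wt_SW ?dimer_wt_NW ?dimer_delta
     ?oner_neq0.
Qed.

Let K := contract (square_move G) (fun v : zpoint => inl v : sq_vertex).

Lemma shuffled_black (v : zpoint) : isblack K v = dimer_white v.
Proof.
exact: (contract_black dimer_small_wt_neq0 dimer_wt_on_even_face
          dimer_vertex_lattice).
Qed.

Lemma shuffled_wt (i j : int) (u v : zpoint) :
  face_edge (even_centre i j) u v -> wt K u v = small_wt G (even_centre i j) u v.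
Proof.
apply: (contract_wt dimer_small_wt_neq0 dimer_wt_on_even_face).
exact: even_face_centre.
Qed.

(** Needed because odd faces run through the sides of their neighbours in the
    opposite direction. *)
Lemma shuffled_wtC (i j : int) (u v : zpoint) :
  face_edge (even_centre i j) u v -> wt K v u = wt K u v.
Proof.
by move=> e; rewrite (shuffled_wt i j) 1?face_edgeC // small_wtC -shuffled_wt.
Qed.

Lemma shuffled_wts (i j : int) (f := even_centre i j) (D := a i j + b i j) :
  [/\ wt K (north f) (east f) = b i j / D,
      wt K (east f) (south f) = a i j / D,
      wt K (south f) (west f) = D^-1 &
      wt K (west f) (north f) = D^-1].
Proof.
split; rewrite (shuffled_wt i j) -/f;
  try by rewrite /face_edge /same_edge !eqxx ?orbT.
- by rewrite small_wt_NE dimer_delta dimer_wt_SW.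
- by rewrite small_wt_SE dimer_delta dimer_wt_NW.
- by rewrite small_wt_SW dimer_delta dimer_wt_NE mul1r.
- by rewrite small_wt_NW dimer_delta dimer_wt_SE mul1r.
Qed.

Lemma shuffled_wtsC (i j : int) (f := even_centre i j) (D := a i j + b i j) :
  [/\ wt K (east f) (north f) = b i j / D,
      wt K (south f) (east f) = a i j / D,
      wt K (west f) (south f) = D^-1 &
      wt K (north f) (west f) = D^-1].
Proof.
have [ne se sw nw] := shuffled_wts i j.
by split; rewrite (shuffled_wtC i j) //;
   rewrite /face_edge /same_edge !eqxx ?orbT.
Qed.

(** The contracted graph has its colours exchanged, so this is the inverse of the
    original face weight: the square move inverts the weights of even faces. *)
Lemma contract_face_weight_even (i j : int) :
  face_weight K (even_centre i j) = b i j / a i j.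
Proof.
rewrite /face_weight /edge_factor !shuffled_black.
have [-> -> -> ->] := shuffled_wts i j.
rewrite /even_centre; unfold_dimer; decide_ifs.
by field; rewrite ?a_neq0 ?b_neq0 ?ab_neq0 ?oner_neq0.
Qed.

(** The NW, NE, SE and SW edges of an odd face are the SE, SW, NW and NE edges of
    the even faces diagonally adjacent to it in those directions. *)
Lemma contract_face_weight_odd (i j : int) (D := fun k l => a k l + b k l) :
  face_weight K (odd_centre i j) =
  (a i (j + 1) / D i (j + 1) * D (i + 1) (j + 1)) /
  (b i j / D i j * D (i + 1) j).
Proof.
rewrite /face_weight /edge_factor !shuffled_black.
set g := odd_centre i j.
have -> : dimer_white (west g) = true by rewrite /g; unfold_dimer; lia.
have -> : dimer_white (north g) = false by rewrite /g; unfold_dimer; lia.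
have -> : dimer_white (east g) = true by rewrite /g; unfold_dimer; lia.
have -> : dimer_white (south g) = false by rewrite /g; unfold_dimer; lia.
have -> : wt K (west g) (north g) = a i (j + 1) / (a i (j + 1) + b i (j + 1)).
  have [_ <- _ _] := shuffled_wtsC i (j + 1).
  by congr (wt K _ _); apply: zpoint_eq => /=; lia.
have -> : wt K (north g) (east g) = (a (i + 1) (j + 1) + b (i + 1) (j + 1))^-1.
  have [_ _ <- _] := shuffled_wtsC (i + 1) (j + 1).
  by congr (wt K _ _); apply: zpoint_eq => /=; lia.
have -> : wt K (east g) (south g) = (a (i + 1) j + b (i + 1) j)^-1.
  have [_ _ _ <-] := shuffled_wtsC (i + 1) j.
  by congr (wt K _ _); apply: zpoint_eq => /=; lia.
have -> : wt K (south g) (west g) = b i j / (a i j + b i j).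
  have [<- _ _ _] := shuffled_wtsC i j.
  by congr (wt K _ _); apply: zpoint_eq => /=; lia.
by rewrite /D; field; rewrite ?a_neq0 ?b_neq0 ?ab_neq0 ?oner_neq0.
Qed.

Lemma shuffle_face_weight_even (i j : int) :
  face_weight (domino_shuffle G) (even_centre i j) =
  F_even (hat_a a b) (hat_b a b) i j.
Proof.
rewrite /domino_shuffle face_weight_translate.
rewrite [X in face_weight _ X](_ : _ = odd_centre i (j - 1));
  last by apply: zpoint_eq => /=; lia.
rewrite contract_face_weight_odd subrK /F_even /hat_a /hat_b.
by field; rewrite ?a_neq0 ?b_neq0 ?ab_neq0 ?oner_neq0.
Qed.

Lemma shuffle_face_weight_odd (i j : int) :
  face_weight (domino_shuffle G) (odd_centre i j) =
  F_odd (hat_a a b) (hat_b a b) i j.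
Proof.
rewrite /domino_shuffle face_weight_translate.
rewrite [X in face_weight _ X](_ : _ = even_centre (i + 1) j);
  last by apply: zpoint_eq => /=; lia.
rewrite contract_face_weight_even /F_odd /hat_a /hat_b addrK.
by field; rewrite ?a_neq0 ?b_neq0 ?ab_neq0 ?oner_neq0.
Qed.

End Dimer.

(** * Transition matrices *)

Section TransitionMatrices.

Context {R : fieldType}.

Lemma zmul_diagr (A : zmx R) (d : int -> R) :
  zmul A (zdiag d) = fun i j => A i j * d j.
Proof.
apply/funext => i; apply/funext => j; rewrite /zmul.
rewrite -(@fsbig_widen _ _ _ _ [set j]%classic) //.
  by rewrite fsbig_set1 /zdiag eqxx.
by move=> k [_ /eqP kj]; rewrite /= /zdiag (negbTE kj) mulr0.
Qed.

Lemma zmul_diagl (A : zmx R) (d : int -> R) :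
  zmul (zdiag d) A = fun i j => d i * A i j.
Proof.
apply/funext => i; apply/funext => j; rewrite /zmul.
rewrite -(@fsbig_widen _ _ _ _ [set i]%classic) //.
  by rewrite fsbig_set1 /zdiag eqxx.
by move=> k [_ /eqP ki]; rewrite /= /zdiag eq_sym (negbTE ki) mul0r.
Qed.

(** Only the entries (j, j) and (j + 1, j) are nonzero, and right multiplication
    by the diagonal factors scales both by the entry of index j. On the
    subdiagonal this is one less than the row index, whence the shift in
    [hat_b]. *)
Lemma hat_trans_mxE (a b : int -> int -> R) (k : int) :
  hat_trans_mx a b k = trans_mx (hat_a a b) (hat_b a b) k.
Proof.
rewrite /hat_trans_mx /trans_mx; case: ifP => // _.
rewrite /X_mx /X_inv !zmul_diagr !zmul_diagl /zadd.
apply/funext => i; apply/funext => j.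
rewrite /zdiag /shift_mx /sigma /hat_a /hat_b.
have [<- | _] := eqVneq i j.
  have -> : (i == i + 1) = false by lia.
  by rewrite !mulr0 !addr0 -!mulrA [X in _ * X]mulrC.
rewrite !add0r; have [-> | _] := eqVneq i (j + 1); last by rewrite !mulr0 !mul0r.
by rewrite addrK !mulr1 -mulrA [X in _ * X]mulrC.
Qed.

End TransitionMatrices.

Theorem corollary5p5 (R : realFieldType) (a b : int -> int -> R)
    (ha : forall i j : int, 0 < a i j) (hb : forall i j : int, 0 < b i j) :
  let G := dimer_graph a b in
  let G' := domino_shuffle G in
  let a' := hat_a a b in
  let b' := hat_b a b in
  (forall k : int, hat_trans_mx a b k = trans_mx a' b' k) /\
  (forall i j : int,
     face_weight G (2 * i + 1, 2 * j + 1) = F_even a b i j /\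
     face_weight G (2 * i + 2, 2 * j + 2) = F_odd a b i j) /\
  (forall i j : int,
     face_weight G' (2 * i + 1, 2 * j + 1) = F_even a' b' i j /\
     face_weight G' (2 * i + 2, 2 * j + 2) = F_odd a' b' i j).
Proof.
have a_neq0 i j : a i j != 0 by rewrite gt_eqF.
have b_neq0 i j : b i j != 0 by rewrite gt_eqF.
have ab_neq0 i j : a i j + b i j != 0 by rewrite gt_eqF // addr_gt0.
split; first exact: hat_trans_mxE.
split=> i j; split.
- exact: dimer_face_weight_even.
- exact: dimer_face_weight_odd.
- exact: shuffle_face_weight_even.
- exact: shuffle_face_weight_odd.
Qed.
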